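(* Let $(\mathscr A,\mathscr B,\mathscr C)$ be a recollement of abelian categories, where the abelian categories have enough projectives and injectives, and let $m\ge1$ be an integer. The following are equivalent: (i) $\sup\{\operatorname{pd}_{\mathscr B}\mathsf i(P)\mid P\in\operatorname{Proj}\mathscr A\}\le m$. (ii) $\Sigma^m(\mathscr B)\subseteq\{B\in\mathscr B\mid\operatorname{Ext}^n_{\mathscr B}(\mathsf i(P),B)=0\text{ for all }P\in\operatorname{Proj}\mathscr A\text{ and all }n\ge1\}$. (iii) For every projective object $P$ in $\mathscr B$, we have $\operatorname{pd}_{\mathscr B}H(P)\le m-1$. If $m=1$, then conditions (i), (ii) and (iii) are equivalent to the following one: (iv) The functor $\mathsf i\colon\mathscr A\to\mathscr B$ is a homological embedding and the quotient functor $\mathsf e\colon\mathscr B\to\mathscr C$ preserves projective objects.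
   Context: A recollement $(\mathscr A,\mathscr B,\mathscr C)$ of abelian categories consists of functors $\mathsf i\colon\mathscr A\to\mathscr B$, $\mathsf e\colon\mathscr B\to\mathscr C$, $\mathsf q,\mathsf p\colon\mathscr B\to\mathscr A$, $\mathsf l,\mathsf r\colon\mathscr C\to\mathscr B$ such that $(\mathsf l,\mathsf e)$, $(\mathsf e,\mathsf r)$, $(\mathsf q,\mathsf i)$, $(\mathsf i,\mathsf p)$ are adjoint pairs, the functors $\mathsf i,\mathsf l,\mathsf r$ are fully faithful, and the essential image of $\mathsf i$ equals $\operatorname{Ker}\mathsf e=\{B\in\mathscr B\mid\mathsf e(B)=0\}$. $\operatorname{Proj}\mathscr A$ is the class of projective objects of $\mathscr A$. The endofunctor $H\colon\mathscr B\to\mathscr B$ is defined by the short exact sequences $0\to H(B)\to B\to\mathsf i\mathsf q(B)\to0$, where $B\to\mathsf i\mathsf q(B)$ is the unit of $(\mathsf q,\mathsf i)$. For an injective coresolution $0\to B\to I^0\to I^1\to\cdots$ of an object $B$ of $\mathscr B$, the image of $I^{m-1}\to I^m$ is an $m$-th cosyzygy of $B$; $\Sigma^m(\mathscr B)$ is the full subcategory of $\mathscr B$ consisting of all $m$-th cosyzygy objects. An exact functor $\mathsf i\colon\mathscr A\to\mathscr B$ between abelian categories is a homological embedding if the induced map $\operatorname{Ext}^n_{\mathscr A}(X,Y)\to\operatorname{Ext}^n_{\mathscr B}(\mathsf i(X),\mathsf i(Y))$ is an isomorphism for all objects $X,Y$ of $\mathscr A$ and all $n\ge0$. *)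

(* Defs.v *)
From HB Require Import structures.
From mathcomp Require Import all_boot all_algebra.
From mathcomp Require Import boolp.

Set Implicit Arguments.
Unset Strict Implicit.
Unset Printing Implicit Defensive.

Import GRing.Theory.
Local Open Scope ring_scope.
Local Open Scope quotient_scope.

Declare Scope cat_scope.
Delimit Scope cat_scope with cat.
Reserved Notation "g ∘ f" (at level 40, left associativity).

Record preadditive := Preadditive {
  obj :> Type;
  hom : obj -> obj -> zmodType;
  idm : forall X, hom X X;
  compose : forall X Y Z, hom Y Z -> hom X Y -> hom X Z;
  compose1m : forall X Y (f : hom X Y), compose (idm Y) f = f;
  composem1 : forall X Y (f : hom X Y), compose f (idm X) = f;
  composeA : forall W X Y Z (h : hom Y Z) (g : hom X Y) (f : hom W X),
    compose h (compose g f) = compose (compose h g) f;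
  composeDl : forall X Y Z (g g' : hom Y Z) (f : hom X Y),
    compose (g + g') f = compose g f + compose g' f;
  composeDr : forall X Y Z (g : hom Y Z) (f f' : hom X Y),
    compose g (f + f') = compose g f + compose g f' }.

Arguments hom {p} X Y.
Arguments idm {p} X.
Notation "g ∘ f" := (compose g f) : cat_scope.
Local Open Scope cat_scope.

Section Preadditive.
Variable C : preadditive.
Implicit Types X Y Z W K Q : C.

Definition isomorphic X Y :=
  exists (f : hom X Y) (g : hom Y X), g ∘ f = idm X /\ f ∘ g = idm Y.

Definition is_mono X Y (f : hom X Y) :=
  forall W (g h : hom W X), f ∘ g = f ∘ h -> g = h.

Definition is_epi X Y (f : hom X Y) :=
  forall Z (g h : hom Y Z), g ∘ f = h ∘ f -> g = h.

Definition is_zero Z :=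
  (forall X (f g : hom Z X), f = g) /\ (forall X (f g : hom X Z), f = g).

Definition is_kernel X Y (f : hom X Y) K (k : hom K X) :=
  f ∘ k = 0 /\
  forall W (g : hom W X), f ∘ g = 0 -> exists! h : hom W K, k ∘ h = g.

Definition is_cokernel X Y (f : hom X Y) Q (c : hom Y Q) :=
  c ∘ f = 0 /\
  forall Z (g : hom Y Z), g ∘ f = 0 -> exists! h : hom Q Z, h ∘ c = g.

Definition is_biproduct X Y S (i1 : hom X S) (i2 : hom Y S)
    (p1 : hom S X) (p2 : hom S Y) :=
  [/\ p1 ∘ i1 = idm X, p2 ∘ i2 = idm Y, p1 ∘ i2 = 0, p2 ∘ i1 = 0
    & i1 ∘ p1 + i2 ∘ p2 = idm S].

Definition projective P :=
  forall X Y (g : hom X Y) (f : hom P Y), is_epi g ->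
  exists h : hom P X, g ∘ h = f.

Definition injective_obj I :=
  forall X Y (g : hom X Y) (f : hom X I), is_mono g ->
  exists h : hom Y I, h ∘ g = f.

Definition enough_projectives :=
  forall X, exists (P : C) (p : hom P X), projective P /\ is_epi p.

Definition enough_injectives :=
  forall X, exists (I : C) (j : hom X I), injective_obj I /\ is_mono j.

End Preadditive.

Record abelian := Abelian {
  abelian_cat :> preadditive;
  zero_ex : exists Z : abelian_cat, is_zero Z;
  biproduct_ex : forall X Y : abelian_cat,
    exists (S : abelian_cat) (i1 : hom X S) (i2 : hom Y S)
      (p1 : hom S X) (p2 : hom S Y), is_biproduct i1 i2 p1 p2;
  kernel_ex : forall (X Y : abelian_cat) (f : hom X Y),
    exists (K : abelian_cat) (k : hom K X), is_kernel f k;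
  cokernel_ex : forall (X Y : abelian_cat) (f : hom X Y),
    exists (Q : abelian_cat) (c : hom Y Q), is_cokernel f c;
  mono_normal : forall (X Y : abelian_cat) (f : hom X Y), is_mono f ->
    exists (Z : abelian_cat) (g : hom Y Z), is_kernel g f;
  epi_normal : forall (X Y : abelian_cat) (f : hom X Y), is_epi f ->
    exists (W : abelian_cat) (g : hom W X), is_cokernel g f }.

Section PreadditiveTheory.
Variable C : preadditive.
Implicit Types X Y Z W : C.

Lemma compose0m X Y Z (f : hom X Y) : (0 : hom Y Z) ∘ f = 0.
Proof. by apply: (addrI (0 ∘ f)); rewrite -composeDl !addr0. Qed.

Lemma composem0 X Y Z (g : hom Y Z) : g ∘ (0 : hom X Y) = 0.
Proof. by apply: (addrI (g ∘ 0)); rewrite -composeDr !addr0. Qed.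

Lemma composeNl X Y Z (g : hom Y Z) (f : hom X Y) : (- g) ∘ f = - (g ∘ f).
Proof. by apply: (addrI (g ∘ f)); rewrite -composeDl !subrr compose0m. Qed.

Lemma composeNr X Y Z (g : hom Y Z) (f : hom X Y) : g ∘ (- f) = - (g ∘ f).
Proof. by apply: (addrI (g ∘ f)); rewrite -composeDr !subrr composem0. Qed.

Lemma composeBl X Y Z (g h : hom Y Z) (f : hom X Y) :
  (g - h) ∘ f = g ∘ f - h ∘ f.
Proof. by rewrite composeDl composeNl. Qed.

Lemma composeBr X Y Z (g : hom Y Z) (f h : hom X Y) :
  g ∘ (f - h) = g ∘ f - g ∘ h.
Proof. by rewrite composeDr composeNr. Qed.

Lemma epi0P X Y (f : hom X Y) :
  (forall Z (g : hom Y Z), g ∘ f = 0 -> g = 0) -> is_epi f.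
Proof.
move=> H Z g h e; apply/eqP; rewrite -subr_eq0; apply/eqP/H.
by rewrite composeBl e subrr.
Qed.

Lemma epi0 X Y (f : hom X Y) : is_epi f ->
  forall Z (g : hom Y Z), g ∘ f = 0 -> g = 0.
Proof. by move=> H Z g e; apply: H; rewrite e compose0m. Qed.

Lemma mono0P X Y (f : hom X Y) :
  (forall W (g : hom W X), f ∘ g = 0 -> g = 0) -> is_mono f.
Proof.
move=> H W g h e; apply/eqP; rewrite -subr_eq0; apply/eqP/H.
by rewrite composeBr e subrr.
Qed.

Lemma mono0 X Y (f : hom X Y) : is_mono f ->
  forall W (g : hom W X), f ∘ g = 0 -> g = 0.
Proof. by move=> H W g e; apply: H; rewrite e composem0. Qed.

Lemma is_kernel_mono X Y Z (f : hom X Y) (k : hom Z X) :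
  is_kernel f k -> is_mono k.
Proof.
case=> fk U W g h e.
have [|u [_ hu]] := U W (k ∘ g); first by rewrite composeA fk compose0m.
by rewrite -(hu g) // -(hu h).
Qed.

End PreadditiveTheory.

Section Abelian.
Variable C : abelian.
Implicit Types X Y Z W : C.

Definition Ker X Y (f : hom X Y) : C := projT1 (cid (kernel_ex f)).
Definition ker X Y (f : hom X Y) : hom (Ker f) X :=
  projT1 (cid (projT2 (cid (kernel_ex f)))).
Lemma kerP X Y (f : hom X Y) : is_kernel f (ker f).
Proof. exact: projT2 (cid (projT2 (cid (kernel_ex f)))). Qed.

Definition Coker X Y (f : hom X Y) : C := projT1 (cid (cokernel_ex f)).
Definition coker X Y (f : hom X Y) : hom Y (Coker f) :=
  projT1 (cid (projT2 (cid (cokernel_ex f)))).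
Lemma cokerP X Y (f : hom X Y) : is_cokernel f (coker f).
Proof. exact: projT2 (cid (projT2 (cid (cokernel_ex f)))). Qed.

Definition Im X Y (f : hom X Y) : C := Ker (coker f).
Definition im X Y (f : hom X Y) : hom (Im f) Y := ker (coker f).

(* exactness at Y: the image of f is the kernel of g, as subobjects of Y *)
Definition exact X Y Z (f : hom X Y) (g : hom Y Z) := is_kernel g (im f).

Definition short_exact X Y Z (f : hom X Y) (g : hom Y Z) :=
  [/\ is_mono f, exact f g & is_epi g].

Lemma ker_mono X Y (f : hom X Y) : is_mono (ker f).
Proof. exact: is_kernel_mono (kerP f). Qed.

Lemma compose_ker X Y (f : hom X Y) : f ∘ ker f = 0.
Proof. by case: (kerP f). Qed.

Lemma coker_compose X Y (f : hom X Y) : coker f ∘ f = 0.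
Proof. by case: (cokerP f). Qed.

Lemma coker_desc X Y Z (f : hom X Y) (g : hom Y Z) : g ∘ f = 0 ->
  exists h, h ∘ coker f = g.
Proof. by case: (cokerP f) => _ U /U [h [e _]]; exists h. Qed.

Lemma ker_lift_ex X Y W (f : hom X Y) (g : hom W X) : f ∘ g = 0 ->
  exists h : hom W (Ker f), ker f ∘ h = g.
Proof. by case: (kerP f) => _ U /U [h [e _]]; exists h. Qed.

Definition ker_lift X Y W (f : hom X Y) (g : hom W X) (e : f ∘ g = 0) :=
  projT1 (cid (ker_lift_ex e)).

Lemma ker_liftK X Y W (f : hom X Y) (g : hom W X) (e : f ∘ g = 0) :
  ker f ∘ ker_lift e = g.
Proof. exact: projT2 (cid (ker_lift_ex e)). Qed.

Lemma im_factor X Y (f : hom X Y) :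
  exists e : hom X (Im f), im f ∘ e = f /\ is_epi e.
Proof.
have [e fe] := ker_lift_ex (coker_compose f); exists e; split=> //.
apply: epi0P => T g ge0; have [e' ee'] := ker_lift_ex ge0.
have mk : is_mono (im f ∘ ker g).
  by move=> W a b; rewrite -!composeA => /ker_mono/ker_mono.
have [W [h [hmk U]]] := mono_normal mk.
have hf0 : h ∘ f = 0 by rewrite -fe -ee' !composeA -(composeA h) hmk compose0m.
have [h' hh'] := coker_desc hf0.
have [|t [et _]] := U _ (im f).
  by rewrite -hh' -composeA compose_ker composem0.
have kt : ker g ∘ t = idm _ by apply: (@ker_mono _ _ (coker f)); rewrite composeA et composem1.
by rewrite -(composem1 g) -kt composeA compose_ker compose0m.
Qed.

Lemma exact_comp0 X Y Z (f : hom X Y) (g : hom Y Z) : exact f g -> g ∘ f = 0.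
Proof.
by case=> gi _; have [e [fe _]] := im_factor f; rewrite -{1}fe composeA gi compose0m.
Qed.

Lemma exact_ker_epi X Y Z W (g : hom Y Z) (k : hom X Y) (e : hom W X) :
  is_kernel g k -> is_epi e -> exact (k ∘ e) g.
Proof.
move=> [gk U] epie; split.
  have [|h <-] := @coker_desc _ _ _ (k ∘ e) g; first by rewrite composeA gk compose0m.
  by rewrite -composeA compose_ker composem0.
move=> T t /U [t' [kt' _]].
have ck : coker (k ∘ e) ∘ k = 0.
  by apply: (epi0 epie); rewrite -composeA coker_compose.
have [|u iu] := @ker_lift_ex _ _ _ (coker (k ∘ e)) t.
  by rewrite -kt' composeA ck compose0m.
by exists u; split=> // v iv; apply: (@ker_mono _ _ (coker (k ∘ e))); rewrite iu.
Qed.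

Lemma exact_ker X Y (g : hom X Y) : exact (ker g) g.
Proof.
by rewrite -(composem1 (ker g)); apply: (exact_ker_epi (kerP g)) => T a b; rewrite !composem1.
Qed.

Lemma exact_proj_lift X Y Z P (f : hom X Y) (g : hom Y Z) (h : hom P Y) :
  exact f g -> projective P -> g ∘ h = 0 -> exists t : hom P X, f ∘ t = h.
Proof.
case=> gi U prP /U [h' [ih' _]]; have [e [fe epie]] := im_factor f.
by have [t et] := prP _ _ e h' epie; exists t; rewrite -fe -composeA et.
Qed.

Lemma is_zero_proj Z : is_zero Z -> projective Z.
Proof. by case=> z _ X Y g f _; exists 0; apply: z. Qed.

End Abelian.

Section Resolutions.
Variable C : abelian.

Record proj_resolution (X : C) := ProjResolution {
  pr_obj :> nat -> C;
  pr_d : forall n, hom (pr_obj n.+1) (pr_obj n);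
  pr_aug : hom (pr_obj 0%N) X;
  pr_proj : forall n, projective (pr_obj n);
  pr_aug_epi : is_epi pr_aug;
  pr_exact0 : exact (pr_d 0%N) pr_aug;
  pr_exactS : forall n, exact (pr_d n.+1) (pr_d n) }.

Record inj_coresolution (X : C) := InjCoresolution {
  ic_obj :> nat -> C;
  ic_d : forall n, hom (ic_obj n) (ic_obj n.+1);
  ic_aug : hom X (ic_obj 0%N);
  ic_inj : forall n, injective_obj (ic_obj n);
  ic_aug_mono : is_mono ic_aug;
  ic_exact0 : exact ic_aug (ic_d 0%N);
  ic_exactS : forall n, exact (ic_d n) (ic_d n.+1) }.

Definition pd_le (X : C) (m : nat) :=
  exists P : proj_resolution X, forall n, (m < n)%N -> is_zero (P n).

(* meaningful for 0 < m *)
Definition cosyzygy (m : nat) (X : C) :=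
  exists (B : C) (I : inj_coresolution B), isomorphic X (Im (ic_d I m.-1)).

End Resolutions.

Arguments pr_d {C X} p n.
Arguments pr_aug {C X} p.
Arguments ic_d {C X} i n.
Arguments ic_aug {C X} i.

Section ResolutionExistence.
Variables (C : abelian) (hC : enough_projectives C) (X : C).

Let cover (Y : C) : C := projT1 (cid (hC Y)).
Let cov (Y : C) : hom (cover Y) Y := projT1 (cid (projT2 (cid (hC Y)))).
Let covP (Y : C) : projective (cover Y) /\ is_epi (cov Y).
Proof. exact: projT2 (cid (projT2 (cid (hC Y)))). Qed.

Record arrow := Arrow { a_dom : C; a_cod : C; a_map : hom a_dom a_cod }.
Let next (a : arrow) : arrow :=
  Arrow (ker (a_map a) ∘ cov (Ker (a_map a))).
Let st (n : nat) : arrow := iter n next (Arrow (cov X)).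

Lemma proj_resolution_ex : exists _ : proj_resolution X, True.
Proof.
have pr n : projective (a_dom (st n)) by case: n => [|n]; apply: (covP _).1.
unshelve eexists (@ProjResolution C X (fun n => a_dom (st n))
  (fun n => a_map (st n.+1)) (cov X) pr _ _ _) => //.
- exact: (covP X).2.
- exact: (exact_ker_epi (kerP (cov X)) (covP _).2).
- move=> n; exact: (exact_ker_epi (kerP (a_map (st n.+1))) (covP _).2).
Qed.

Definition some_proj_resolution : proj_resolution X :=
  projT1 (cid proj_resolution_ex).

End ResolutionExistence.

Section ExtOfResolution.
Variables (C : abelian) (X : C) (P : proj_resolution X) (n : nat) (Y : C).

Definition is_cocycle : pred (hom (P n) Y) := fun f => f ∘ pr_d P n == 0.

Lemma is_cocycle_closed : zmod_closed is_cocycle.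
Proof.
split=> [|f g /eqP f0 /eqP g0]; apply/eqP; first exact: compose0m.
by rewrite composeBl f0 g0 subr0.
Qed.
HB.instance Definition _ := GRing.isZmodClosed.Build _ is_cocycle is_cocycle_closed.

Record cocycle := Cocycle {
  cocycle_val :> hom (P n) Y;
  _ : is_cocycle cocycle_val }.
HB.instance Definition _ := [isSub for cocycle_val].
HB.instance Definition _ := [Choice of cocycle by <:].
HB.instance Definition _ := [SubChoice_isSubZmodule of cocycle by <:].

Lemma cocycle_valD (f g : cocycle) :
  cocycle_val (f + g) = cocycle_val f + cocycle_val g.
Proof. exact: (raddfD val). Qed.

Lemma cocycle_valB (f g : cocycle) :
  cocycle_val (f - g) = cocycle_val f - cocycle_val g.
Proof. exact: (raddfB val). Qed.

End ExtOfResolution.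

Definition is_coboundary (C : abelian) (X : C) (P : proj_resolution X) (n : nat)
    (Y : C) : hom (P n) Y -> Prop :=
  match n with
  | 0 => fun f => f = 0
  | k.+1 => fun f => exists g : hom (P k) Y, f = g ∘ pr_d P k
  end.

Section ExtGroup.
Variables (C : abelian) (X : C) (P : proj_resolution X) (n : nat) (Y : C).

Definition coboundaries : pred (cocycle P n Y) :=
  fun f => `[< is_coboundary (cocycle_val f) >].

Lemma coboundaries_closed : zmod_closed coboundaries.
Proof.
split=> [|f g /asboolP hf /asboolP hg]; apply/asboolP.
  by case: n => [|k] //=; exists 0; rewrite compose0m.
rewrite cocycle_valB.
move: (cocycle_val f) (cocycle_val g) hf hg => {f g}.
case: n => [|k] /= a b; first by move=> -> ->; rewrite subr0.
by move=> [u ->] [v ->]; exists (u - v); rewrite composeBl.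
Qed.
HB.instance Definition _ :=
  GRing.isZmodClosed.Build _ coboundaries coboundaries_closed.

Definition coboundary_group : zmodClosed (cocycle P n Y) :=
  GRing.ZmodClosed.clone _ coboundaries _.

Definition Ext_res : zmodType := Quotient.quot coboundary_group.

Definition Ext_class (f : cocycle P n Y) : Ext_res := \pi f.

Lemma Ext_classP (f g : cocycle P n Y) :
  Ext_class f = Ext_class g <->
  is_coboundary (cocycle_val f - cocycle_val g).
Proof.
have E := Quotient.idealrBE coboundary_group f g; rewrite -cocycle_valB; split=> [e|h].
  have : f - g \in coboundary_group by rewrite E; apply/eqP.
  by rewrite unfold_in => /asboolP.
by apply/eqP; rewrite /Ext_class -E unfold_in; apply/asboolP.
Qed.

Lemma Ext_classK (x : Ext_res) : Ext_class (repr x) = x.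
Proof. exact: reprK. Qed.

Lemma Ext_classD : {morph Ext_class : f g / f + g}.
Proof. by move=> f g; rewrite /Ext_class /= piE. Qed.

End ExtGroup.


(* Ext computed from a projective resolution of the first argument, chosen once
   and for all *)
Definition Ext (C : abelian) (hC : enough_projectives C) (n : nat) (X Y : C) :
    zmodType :=
  Ext_res (some_proj_resolution hC X) n Y.

Definition Ext_vanishes (C : abelian) (hC : enough_projectives C) (n : nat)
    (X Y : C) :=
  forall x : Ext hC n X Y, x = 0.

Record functor (C D : abelian) := Functor {
  fobj :> C -> D;
  fmap : forall X Y : C, hom X Y -> hom (fobj X) (fobj Y);
  fmap_id : forall X : C, fmap (idm X) = idm (fobj X);
  fmap_comp : forall (X Y Z : C) (g : hom Y Z) (f : hom X Y),
    fmap (g ∘ f) = fmap g ∘ fmap f }.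

Arguments fmap {C D} f {X Y} _ : rename.

Section Functors.
Variables C D : abelian.

Definition fully_faithful (F : functor C D) :=
  forall X Y : C, bijective (fmap F : hom X Y -> hom (F X) (F Y)).

Definition exact_functor (F : functor C D) :=
  (forall (X Y : C) (f g : hom X Y), fmap F (f + g) = fmap F f + fmap F g) /\
  (forall (X Y Z : C) (f : hom X Y) (g : hom Y Z),
     exact f g -> exact (fmap F f) (fmap F g)).

Definition preserves_projectives (F : functor C D) :=
  forall P : C, projective P -> projective (F P).

Record adjunction (F : functor C D) (G : functor D C) := Adjunction {
  unit : forall X : C, hom X (G (F X));
  counit : forall Y : D, hom (F (G Y)) Y;
  unit_nat : forall (X Y : C) (f : hom X Y),
    fmap G (fmap F f) ∘ unit X = unit Y ∘ f;
  counit_nat : forall (X Y : D) (f : hom X Y),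
    f ∘ counit X = counit Y ∘ fmap F (fmap G f);
  unit_counit : forall X : C, counit (F X) ∘ fmap F (unit X) = idm (F X);
  counit_unit : forall Y : D, fmap G (counit Y) ∘ unit (G Y) = idm (G Y) }.

End Functors.

Section HomologicalEmbedding.
Variables (C D : abelian) (hC : enough_projectives C)
  (hD : enough_projectives D) (F : functor C D) (exF : exact_functor F).

Lemma fmap0 (X Y : C) : fmap F (0 : hom X Y) = 0.
Proof. by apply: (addrI (fmap F 0)); rewrite -exF.1 !addr0. Qed.

Lemma fmapB (X Y : C) (f g : hom X Y) : fmap F (f - g) = fmap F f - fmap F g.
Proof. by apply/eqP; rewrite eq_sym subr_eq -exF.1 subrK. Qed.

Lemma is_zero_fmap (Z : C) : is_zero Z -> is_zero (F Z).
Proof.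
move=> [z _]; have e : idm (F Z) = 0.
  by rewrite -fmap_id (z _ (idm Z) 0) fmap0.
split=> T f g.
  by rewrite -(composem1 f) -(composem1 g) e !composem0.
by rewrite -(compose1m f) -(compose1m g) e !compose0m.
Qed.

Lemma epi_fmap (X Y : C) (f : hom X Y) : is_epi f -> is_epi (fmap F f).
Proof.
move=> epif; have [Z zZ] := zero_ex C.
have ex : exact f (0 : hom Y Z).
  rewrite -(compose1m f); apply: exact_ker_epi epif.
  split=> [|T g _]; first exact: compose0m.
  by exists g; split=> [|h]; rewrite compose1m.
have [_ U] := exF.2 _ _ _ _ _ ex.
have [|s [es _]] := U _ (idm (F Y)); first by rewrite fmap0 compose0m.
have [e [fe epie]] := im_factor (fmap F f).
apply: epi0P => T g; rewrite -fe composeA => /(epi0 epie) g0.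
by rewrite -(composem1 g) -es composeA g0 compose0m.
Qed.

Section Comparison.
Variables (X : C) (P : proj_resolution X) (Q : proj_resolution (F X)).

(* chain maps from Q to F(P) over the identity of F X *)
Definition is_comparison (phi : forall n, hom (Q n) (F (P n))) :=
  fmap F (pr_aug P) ∘ phi 0%N = pr_aug Q /\
  forall n, fmap F (pr_d P n) ∘ phi n.+1 = phi n ∘ pr_d Q n.

Let bnd n : hom (Q n) (F (P n)) -> Prop :=
  match n with
  | 0 => fun a => fmap F (pr_aug P) ∘ a ∘ pr_d Q 0%N = 0
  | k.+1 => fun a => fmap F (pr_d P k) ∘ a ∘ pr_d Q k.+1 = 0
  end.

Lemma comparison_ex : exists phi, is_comparison phi.
Proof.
have step n (a : hom (Q n) (F (P n))) : bnd a ->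
    exists b : hom (Q n.+1) (F (P n.+1)),
      bnd b /\ fmap F (pr_d P n) ∘ b = a ∘ pr_d Q n.
  move=> ba; have [|||b eb] := @exact_proj_lift D _ _ _ (Q n.+1)
      (fmap F (pr_d P n)) (if n is k.+1 as n return hom (F (P n))
         (if n is k.+1 then F (P k) else F X)
       then fmap F (pr_d P k) else fmap F (pr_aug P)) (a ∘ pr_d Q n).
  - by case: n {a ba} => [|k]; apply: exF.2; [apply: pr_exact0|apply: pr_exactS].
  - exact: pr_proj.
  - by move: ba; case: n a => [|k] a /= <-; rewrite composeA.
  exists b; split=> //=.
  by rewrite eb -composeA (exact_comp0 (pr_exactS Q n)) composem0.
have [phi0 e0] : exists a, fmap F (pr_aug P) ∘ a = pr_aug Q.
  by apply: pr_proj; apply/epi_fmap/pr_aug_epi.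
have b0 : bnd phi0 by rewrite /= e0 (exact_comp0 (pr_exact0 Q)).
pose phi := fix phi n : {a : hom (Q n) (F (P n)) | bnd a} :=
  match n with
  | 0 => exist _ phi0 b0
  | k.+1 => let s := cid (step k _ (projT2 (phi k))) in
            exist _ (projT1 s) (projT2 s).1
  end.
exists (fun n => projT1 (phi n)); split=> // n.
exact: (projT2 (cid (step n _ (projT2 (phi n))))).2.
Qed.

Definition comparison : forall n, hom (Q n) (F (P n)) :=
  projT1 (cid comparison_ex).

Lemma comparisonP : is_comparison comparison.
Proof. exact: projT2 (cid comparison_ex). Qed.

Variables (n : nat) (Y : C).

Lemma cocycle_map_subproof (f : cocycle P n Y) :
  is_cocycle (P := Q) (fmap F (cocycle_val f) ∘ comparison n).
Proof.
rewrite /is_cocycle -composeA -comparisonP.2 composeA -fmap_comp.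
by case: f => f /= /eqP ->; rewrite fmap0 compose0m.
Qed.

Definition cocycle_map (f : cocycle P n Y) : cocycle Q n (F Y) :=
  Cocycle (cocycle_map_subproof f).

Definition Ext_res_map (x : Ext_res P n Y) : Ext_res Q n (F Y) :=
  Ext_class (cocycle_map (repr x)).

Lemma Ext_res_map_class (f : cocycle P n Y) :
  Ext_res_map (Ext_class f) = Ext_class (cocycle_map f).
Proof.
apply/Ext_classP; set h := repr _.
have /Ext_classP : Ext_class h = Ext_class f by exact: Ext_classK.
rewrite /= -composeBl -fmapB.
move: (cocycle_val h) (cocycle_val f) => {h f} a b.
case: n a b => [|k] a b /=; first by move=> ->; rewrite fmap0 compose0m.
move=> [g ->]; exists (fmap F g ∘ comparison k).
by rewrite fmap_comp -!composeA comparisonP.2.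
Qed.

Lemma Ext_res_mapD : {morph Ext_res_map : x y / x + y}.
Proof.
move=> x y; rewrite -(Ext_classK x) -(Ext_classK y) -Ext_classD.
rewrite !Ext_res_map_class -Ext_classD; congr Ext_class; apply: val_inj => /=.
by rewrite exF.1 composeDl.
Qed.

End Comparison.

Definition Ext_map (n : nat) (X Y : C) :
    Ext hC n X Y -> Ext hD n (F X) (F Y) :=
  @Ext_res_map X (some_proj_resolution hC X)
    (some_proj_resolution hD (F X)) n Y.

End HomologicalEmbedding.

Definition homological_embedding (C D : abelian) (hC : enough_projectives C)
    (hD : enough_projectives D) (F : functor C D) :=
  exists exF : exact_functor F,
    forall (n : nat) (X Y : C), bijective (@Ext_map C D hC hD F exF n X Y).

Record recollement (A B C : abelian) := Recollement {
  rec_i : functor A B;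
  rec_e : functor B C;
  rec_q : functor B A;
  rec_p : functor B A;
  rec_l : functor C B;
  rec_r : functor C B;
  adj_le : adjunction rec_l rec_e;
  adj_er : adjunction rec_e rec_r;
  adj_qi : adjunction rec_q rec_i;
  adj_ip : adjunction rec_i rec_p;
  ff_i : fully_faithful rec_i;
  ff_l : fully_faithful rec_l;
  ff_r : fully_faithful rec_r;
  essim_i : forall Y : B,
    (exists X : A, isomorphic (rec_i X) Y) <-> is_zero (rec_e Y) }.

Section RecollementH.
Variables (A B C : abelian) (R : recollement A B C).

Definition H_obj (X : B) : B := Ker (unit (adj_qi R) X).

Lemma H_map_subproof (X Y : B) (f : hom X Y) :
  unit (adj_qi R) Y ∘ (f ∘ ker (unit (adj_qi R) X)) = 0.
Proof. by rewrite composeA -unit_nat -composeA compose_ker composem0. Qed.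

Definition H_map (X Y : B) (f : hom X Y) : hom (H_obj X) (H_obj Y) :=
  ker_lift (H_map_subproof f).

Lemma H_map_id (X : B) : H_map (idm X) = idm (H_obj X).
Proof. by apply: ker_mono; rewrite ker_liftK compose1m composem1. Qed.

Lemma H_map_comp (X Y Z : B) (g : hom Y Z) (f : hom X Y) :
  H_map (g ∘ f) = H_map g ∘ H_map f.
Proof.
apply: ker_mono; rewrite ker_liftK composeA [X in _ = X ∘ _]ker_liftK.
by rewrite -[in RHS]composeA ker_liftK composeA.
Qed.

Definition H : functor B B := Functor H_map_id H_map_comp.

Lemma unit_qi_desc_uniq (X : B) (Y : A) (u v : hom (rec_q R X) Y) :
  fmap (rec_i R) u ∘ unit (adj_qi R) X = fmap (rec_i R) v ∘ unit (adj_qi R) X ->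
  u = v.
Proof.
move=> e; rewrite -(composem1 u) -(composem1 v) -(unit_counit (adj_qi R)).
by rewrite !composeA !counit_nat -!composeA -!fmap_comp e.
Qed.

Lemma rec_e_mono (X Y : B) (f : hom X Y) :
  is_mono f -> is_mono (fmap (rec_e R) f).
Proof.
move=> mf W a b e.
have adjE (c : hom W (rec_e R X)) :
    c = fmap (rec_e R) (counit (adj_le R) X ∘ fmap (rec_l R) c)
        ∘ unit (adj_le R) W.
  by rewrite fmap_comp -composeA unit_nat composeA counit_unit compose1m.
rewrite (adjE a) (adjE b); congr (fmap _ _ ∘ _); apply: mf.
by rewrite !composeA counit_nat -!composeA -!fmap_comp e.
Qed.

Lemma unit_qi_epi (X : B) : is_epi (unit (adj_qi R) X).
Proof.
apply: epi0P => Z g geta0.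
have z : is_zero (rec_e R (rec_i R (rec_q R X))).
  by apply/essim_i; exists (rec_q R X), (idm _), (idm _); rewrite !compose1m.
have zK : is_zero (rec_e R (Ker g)).
  have U W (a b : hom W (rec_e R (Ker g))) : a = b.
    by apply: (rec_e_mono (@ker_mono _ _ _ g)); apply: z.2.
  split=> // W a b.
  by rewrite -(composem1 a) -(composem1 b) (U _ (idm _) 0) !composem0.
have [Y [u [v [vu uv]]]] := (essim_i R _).2 zK.
have [t et] := ker_lift_ex geta0.
have [w ew] : exists w : hom (rec_q R X) Y,
    fmap (rec_i R) w ∘ unit (adj_qi R) X = v ∘ t.
  exists (counit (adj_qi R) Y ∘ fmap (rec_q R) (v ∘ t)).
  by rewrite fmap_comp -composeA unit_nat composeA counit_unit compose1m.
have [i' _ ci'] := ff_i R (rec_q R X) (rec_q R X).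
have ks : ker g ∘ u ∘ fmap (rec_i R) w = idm _.
  rewrite -[LHS]ci' -fmap_id; congr (fmap _ _); apply: unit_qi_desc_uniq.
  rewrite ci' fmap_id compose1m -!composeA ew.
  by rewrite (composeA u) uv compose1m.
by rewrite -(composem1 g) -ks !composeA compose_ker !compose0m.
Qed.

Lemma H_short_exact (X : B) :
  short_exact (ker (unit (adj_qi R) X) : hom (H X) X) (unit (adj_qi R) X).
Proof. by split; [apply: ker_mono|apply: exact_ker|apply: unit_qi_epi]. Qed.

End RecollementH.

(* Main.v *)
(* Dimension shifting along an injective coresolution of Y gives
   Ext^(n+1)(X, Y) = Ext^1(X, S^n Y), S^n Y an n-th cosyzygy, and pd X <= n iff
   these groups vanish for all Y; this is (i) <-> (ii). Every projective P of A
   is a summand of q(Q) with Q projective in B, and H(Q) is the first syzygy of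
   i q(Q), whence (i) <-> (iii).

   For m = 1, H(Q) is the image of the counit eps : l e(Q) -> Q. If it is
   projective, then e(eps) being invertible makes e(Q) a retract of e(H(Q)), with
   the lifting property inherited through l, so e(Q) is projective; moreover
   Ext^n(i P, i Y) = 0 for all n >= 1 (for n = 1 because Ker e is closed under
   extensions), so i sends projective resolutions to resolutions by acyclic
   objects, which compute Ext. Conversely, Ext^1(H(Q), i Y) = Ext^2(i q(Q), i Y)
   = Ext^2(q(Q), Y) = 0 splits H(Q) off the projective object l e(Q). *)

From HB Require Import structures.
From mathcomp Require Import all_boot all_algebra.
From mathcomp Require Import boolp.
Require Import Defs.

Set Implicit Arguments.
Unset Strict Implicit.
Unset Printing Implicit Defensive.

Import GRing.Theory.
Local Open Scope ring_scope.
Local Open Scope cat_scope.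

(** * Short exact sequences and injective coresolutions *)

Section AbelianTheory.
Variable C : abelian.
Implicit Types W X Y Z K M I P : C.

Definition ses X Y Z (j : hom X Y) (p : hom Y Z) := is_kernel p j /\ is_epi p.

Lemma kernel_lift X Y K W (f : hom X Y) (k : hom K X) (g : hom W X) :
  is_kernel f k -> f ∘ g = 0 -> exists h, k ∘ h = g.
Proof. by case=> _ U /U [h [e _]]; exists h. Qed.

Lemma ses_mono X Y Z (j : hom X Y) (p : hom Y Z) : ses j p -> is_mono j.
Proof. by case=> /is_kernel_mono. Qed.

Lemma ses0 X Y Z (j : hom X Y) (p : hom Y Z) : ses j p -> p ∘ j = 0.
Proof. by case=> -[]. Qed.

Lemma ses_lift X Y Z W (j : hom X Y) (p : hom Y Z) (t : hom W Y) :
  ses j p -> p ∘ t = 0 -> exists r, j ∘ r = t.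
Proof. by case=> /kernel_lift H _ /H. Qed.

Lemma kernel_of_mono X Y K (f : hom X Y) (k : hom K X) :
  is_mono k -> f ∘ k = 0 ->
  (forall W (g : hom W X), f ∘ g = 0 -> exists h, k ∘ h = g) -> is_kernel f k.
Proof.
move=> mk fk U; split=> // W g /U [h kh]; exists h; split=> // h' kh'.
by apply: mk; rewrite kh kh'.
Qed.

(** The epimorphism [g] is the cokernel of some [a], which factors through [im f]; [h] kills [im f]
    because it kills [f]. *)
Lemma exact_desc X Y Z W (f : hom X Y) (g : hom Y Z) (h : hom Y W) :
  exact f g -> is_epi g -> h ∘ f = 0 -> exists t, t ∘ g = h.
Proof.
move=> ex /epi_normal[V [a [ga U]]] hf.
have [u eu] := kernel_lift ex ga; have [e [fe epie]] := im_factor f.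
have hi : h ∘ im f = 0 by apply: (epi0 epie); rewrite -composeA fe.
have [|t [et _]] := U _ h; first by rewrite -eu composeA hi compose0m.
by exists t.
Qed.

Lemma ses_desc X Y Z W (j : hom X Y) (p : hom Y Z) (h : hom Y W) :
  ses j p -> h ∘ j = 0 -> exists t, t ∘ p = h.
Proof.
move=> [kj ep]; apply: exact_desc => //.
by rewrite -(composem1 j); apply: exact_ker_epi => // T a b; rewrite !composem1.
Qed.

Lemma exact_mono_comp X Y Z W (f : hom X Y) (g : hom Y Z) (h : hom Z W) :
  is_mono h -> exact f g -> exact f (h ∘ g).
Proof.
move=> mh [gf U]; split=> [|T t]; first by rewrite -composeA gf composem0.
by rewrite -composeA => /(mono0 mh)/U.
Qed.

Lemma kernel_mono_comp X Y Z K (g : hom X Y) (h : hom Y Z) (k : hom K X) :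
  is_mono h -> is_kernel (h ∘ g) k -> is_kernel g k.
Proof.
move=> mh [gf U]; split=> [|T t gt].
  by apply: (mono0 mh); rewrite composeA.
by apply: U; rewrite -composeA gt composem0.
Qed.

(** The monomorphism [f] is the kernel of some [h], which kills [im f]; whatever [g] kills factors
    through [im f], hence through [f]. *)
Lemma exact_mono_kernel X Y Z (f : hom X Y) (g : hom Y Z) :
  exact f g -> is_mono f -> is_kernel g f.
Proof.
move=> ex mf; have [V [h [hf U]]] := mono_normal mf.
apply: kernel_of_mono => // [|W t /(kernel_lift ex)[u iu]].
  exact: exact_comp0 ex.
have [e [fe epie]] := im_factor f.
have hi : h ∘ im f = 0 by apply: (epi0 epie); rewrite -composeA fe.
by have [|r [er _]] := U _ t; [rewrite -iu composeA hi compose0m|exists r].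
Qed.

(** [h] descends to the image of [g], a subobject of [Z], and extends from there by injectivity. *)
Lemma exact_inj_ext X Y Z I (f : hom X Y) (g : hom Y Z) (h : hom Y I) :
  exact f g -> injective_obj I -> h ∘ f = 0 -> exists t, t ∘ g = h.
Proof.
move=> ex injI hf; have [e [ge epie]] := im_factor g.
have ex' : exact f e.
  by apply: (kernel_mono_comp (h := im g)); [apply: ker_mono|rewrite ge].
have [t te] := exact_desc ex' epie hf.
have [t' et'] := injI _ _ (im g) t (@ker_mono _ _ _ _).
by exists t'; rewrite -ge composeA et'.
Qed.

Lemma coker_epi X Y (f : hom X Y) : is_epi (coker f).
Proof.
move=> W g h e; have [|u [_ U]] := (cokerP f).2 W (g ∘ coker f).
  by rewrite -composeA coker_compose composem0.
by rewrite -(U g) // -(U h).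
Qed.

Lemma ses_coker X Y (f : hom X Y) : is_mono f -> ses f (coker f).
Proof.
by move=> mf; split; [apply: exact_mono_kernel (kerP _) mf|apply: coker_epi].
Qed.

Lemma ses_ker X Y (f : hom X Y) : is_epi f -> ses (ker f) f.
Proof. by split=> //; apply: kerP. Qed.

Lemma inj_ses_ex (hI : enough_injectives C) Y :
  exists I Z (j : hom Y I) (p : hom I Z), injective_obj I /\ ses j p.
Proof.
have [I [j [injI mj]]] := hI Y.
by exists I, (Coker j), j, (coker j); split=> //; apply: ses_coker.
Qed.

Lemma epi_comp_r X Y Z (f : hom X Y) (g : hom Y Z) : is_epi (g ∘ f) -> is_epi g.
Proof. by move=> ep W a b e; apply: ep; rewrite !composeA e. Qed.

Lemma is_zero_idm X : idm X = 0 -> is_zero X.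
Proof.
move=> id0; split=> T f g.
  by rewrite -(composem1 f) -(composem1 g) id0 !composem0.
by rewrite -(compose1m f) -(compose1m g) id0 !compose0m.
Qed.

Lemma retract_projective X P (s : hom X P) (r : hom P X) :
  r ∘ s = idm X -> projective P -> projective X.
Proof.
move=> rs prP M N g f epig; have [t et] := prP _ _ g (f ∘ r) epig.
by exists (t ∘ s); rewrite composeA et -composeA rs composem1.
Qed.

Lemma injective_coresolution_ex (hI : enough_injectives C) X :
  exists _ : inj_coresolution X, True.
Proof.
pose hull Y : C := projT1 (cid (hI Y)).
pose h Y : hom Y (hull Y) := projT1 (cid (projT2 (cid (hI Y)))).
have hP Y : injective_obj (hull Y) /\ is_mono (h Y).
  exact: projT2 (cid (projT2 (cid (hI Y)))).
(* Each arrow is followed by its cokernel and an embedding of that cokernel into an injective. *)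
pose next (a : arrow C) := Arrow (h (Coker (a_map a)) ∘ coker (a_map a)).
pose st n := iter n next (Arrow (h X)).
have inj n : injective_obj (a_cod (st n)) by case: n => [|n]; apply: (hP _).1.
have ex (a : arrow C) : exact (a_map a) (a_map (next a)).
  by apply: exact_mono_comp (hP _).2 _; apply: kerP.
unshelve eexists (@InjCoresolution C X (fun n => a_cod (st n))
  (fun n => a_map (st n.+1)) (h X) inj _ _ _) => //.
- exact: (hP X).2.
- exact: (ex (st 0%N)).
- by move=> n; apply: (ex (st n.+1)).
Qed.

End AbelianTheory.

(** * Vanishing of Ext by injective dimension shifting *)

Section ExtZero.
Variable C : abelian.
Implicit Types W X Y Z K M I P : C.

(* The vanishing of Ext^(n+1)(X, Y), computed by dimension shifting along
   injectives in the second variable, so that no resolution of X is involved *)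
Fixpoint ext_zero (n : nat) X Y : Prop :=
  forall I Z (j : hom Y I) (p : hom I Z), injective_obj I -> ses j p ->
  match n with
  | 0 => forall f : hom X Z, exists g, p ∘ g = f
  | n'.+1 => ext_zero n' X Z
  end.

Lemma projective_ext_zero n P Y : projective P -> ext_zero n P Y.
Proof.
move=> prP; elim: n Y => [|n IH] Y I Z j p injI sjp; last exact: IH.
by move=> f; apply: prP; apply: sjp.2.
Qed.

Lemma retract_ext_zero n X M Y (s : hom X M) (r : hom M X) :
  r ∘ s = idm X -> ext_zero n M Y -> ext_zero n X Y.
Proof.
move=> rs; elim: n Y => [|n IH] Y E I Z j p injI sjp.
  move=> f; have [g eg] := E I Z j p injI sjp (f ∘ r).
  by exists (g ∘ s); rewrite composeA eg -composeA rs composem1.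
exact/IH/(E I Z j p).
Qed.

(** The second argument enters only through the map [j], so replacing [j] by [j ∘ v] settles every
    [n] without induction. *)
Lemma isomorphic_ext_zero n X Y Y' :
  isomorphic Y' Y -> ext_zero n X Y -> ext_zero n X Y'.
Proof.
move=> [u [v [vu uv]]] E.
have tr I Z (j : hom Y' I) (p : hom I Z) : ses j p -> ses (j ∘ v) p.
  move=> sjp; split; last exact: sjp.2.
  apply: kernel_of_mono => [W a b e||W g /(ses_lift sjp)[t jt]].
  - rewrite -(compose1m a) -(compose1m b) -uv -!composeA; congr (_ ∘ _).
    by apply: (ses_mono sjp); rewrite !composeA.
  - by rewrite composeA (ses0 sjp) compose0m.
  - by exists (u ∘ t); rewrite -composeA (composeA v) vu compose1m.
by case: n E => [|n] E I Z j p injI /tr; apply: E.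
Qed.

(** The stretch Ext^(n+1)(M, Y) -> Ext^(n+1)(K, Y) -> Ext^(n+2)(X, Y) of the long exact sequence.
    For n = 0, the vanishing of Ext^1(X, Z) extends [f] to [M], and that of Ext^1(M, Y) lifts the
    extension to [I]. *)
Lemma ext_zero_kernel (hI : enough_injectives C) n K M X Y
    (k : hom K M) (c : hom M X) :
  ses k c -> ext_zero n M Y -> ext_zero n.+1 X Y -> ext_zero n K Y.
Proof.
move=> skc; elim: n Y => [|n IH] Y EM EX I Z j p injI sjp; last first.
  by apply: IH; [apply: (EM I Z j p)|apply: (EX I Z j p)].
move=> f; have [I' [Z' [j' [p' [injI' sjp']]]]] := inj_ses_ex hI Z.
have [f' ef'] := injI' _ _ k (j' ∘ f) (ses_mono skc).
have [|g eg] := ses_desc (h := p' ∘ f') skc.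
  by rewrite -composeA ef' composeA (ses0 sjp') compose0m.
have [h eh] := EX I Z j p injI sjp I' Z' j' p' injI' sjp' g.
(* [h ∘ c] vanishes on [K] and corrects [f'] so that it lands in [Z]: [v] extends [f]. *)
have [|v ev] := ses_lift (t := f' - h ∘ c) sjp'.
  by rewrite composeBr composeA eh eg subrr.
have [w ew] := EM I Z j p injI sjp v.
exists (w ∘ k); rewrite composeA ew; apply: (ses_mono sjp').
by rewrite composeA ev composeBl ef' -composeA (ses0 skc) composem0 subr0.
Qed.

(** [j] extends to [a] on [M]; lifting the induced map [b] on [X] to [b'] gives the correction
    [b' ∘ c] that makes [a] land in [K]. *)
Lemma ext_zero_retraction (hI : enough_injectives C) K M X
    (k : hom K M) (c : hom M X) :
  ses k c -> ext_zero 0 X K -> exists r, r ∘ k = idm K.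
Proof.
move=> skc E; have [I [Z [j [p [injI sjp]]]]] := inj_ses_ex hI K.
have [a ea] := injI _ _ k j (ses_mono skc).
have [|b eb] := ses_desc (h := p ∘ a) skc; first by rewrite -composeA ea (ses0 sjp).
have [b' eb'] := E I Z j p injI sjp b.
have [|r er] := ses_lift (t := a - b' ∘ c) sjp.
  by rewrite composeBr composeA eb' eb subrr.
exists r; apply: (ses_mono sjp).
by rewrite composeA er composeBl ea -composeA (ses0 skc) !composem0 subr0 composem1.
Qed.

Lemma ses_section K M X (k : hom K M) (c : hom M X) (r : hom M K) :
  ses k c -> r ∘ k = idm K -> exists s, c ∘ s = idm X.
Proof.
move=> skc rk; have [|s es] := ses_desc (h := idm M - k ∘ r) skc.
  by rewrite composeBl -composeA rk composem1 compose1m subrr.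
exists s; apply: skc.2.
by rewrite -composeA es composeBr composeA (ses0 skc) compose0m subr0 composem1 compose1m.
Qed.

Lemma ext_zero_projective (hP : enough_projectives C) (hI : enough_injectives C) X :
  (forall Y, ext_zero 0 X Y) -> projective X.
Proof.
move=> E; have [P [c [prP epic]]] := hP X.
have [r rk] := ext_zero_retraction hI (ses_ker epic) (E _).
have [s cs] := ses_section (ses_ker epic) rk.
exact: retract_projective cs prP.
Qed.

End ExtZero.

(** * Resolutions with arbitrary terms and dimension shifting *)

Record resolution (C : abelian) (X : C) := Resolution {
  res_obj :> nat -> C;
  res_d : forall n, hom (res_obj n.+1) (res_obj n);
  res_aug : hom (res_obj 0%N) X;
  res_aug_epi : is_epi res_aug;
  res_exact0 : exact (res_d 0%N) res_aug;
  res_exactS : forall n, exact (res_d n.+1) (res_d n) }.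

Definition res_of_proj (C : abelian) (X : C) (P : proj_resolution X) :=
  Resolution (@pr_aug_epi _ _ P) (@pr_exact0 _ _ P) (@pr_exactS _ _ P).

(** Unfolds to [is_coboundary] when the resolution is [res_of_proj P]. *)
Definition coboundary (C : abelian) (X : C) (T : resolution X) (n : nat) (Y : C) :
    hom (T n) Y -> Prop :=
  match n with
  | 0 => fun f => f = 0
  | k.+1 => fun f => exists g : hom (T k) Y, f = g ∘ res_d T k
  end.

Section DimensionShift.
Variables (C : abelian) (X : C) (T : resolution X).
Implicit Types Y Z I : C.

Definition cohomology_zero n Y :=
  forall f : hom (T n) Y, f ∘ res_d T n = 0 -> coboundary f.

Lemma res_dd n : res_d T n ∘ res_d T n.+1 = 0.
Proof. exact: exact_comp0 (res_exactS T n). Qed.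

Lemma res_augd : res_aug T ∘ res_d T 0 = 0.
Proof. exact: exact_comp0 (res_exact0 T). Qed.

Variables (Y I Z : C) (j : hom Y I) (p : hom I Z).
Hypotheses (injI : injective_obj I) (sjp : ses j p).
Hypothesis liftT : forall n (f : hom (T n) Z), exists g, p ∘ g = f.

(** The connecting homomorphism of the snake lemma, from degree n in [Z] to degree n + 1 in [Y],
    with the cocycle [p ∘ u] already lifted to [u]. *)
Lemma connecting_map n (u : hom (T n) I) :
  p ∘ u ∘ res_d T n = 0 ->
  exists f : hom (T n.+1) Y, j ∘ f = u ∘ res_d T n /\ f ∘ res_d T n.+1 = 0.
Proof.
rewrite -composeA => /(ses_lift sjp)[f jf]; exists f; split=> //.
by apply: (mono0 (ses_mono sjp)); rewrite composeA jf -composeA res_dd composem0.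
Qed.

(** Connecting maps are surjective onto positive degrees because Hom(-, I) is exact. *)
Lemma connecting_map_inv n (f : hom (T n.+1) Y) :
  f ∘ res_d T n.+1 = 0 ->
  exists u : hom (T n) I, u ∘ res_d T n = j ∘ f /\ p ∘ u ∘ res_d T n = 0.
Proof.
move=> fd; have [|u ud] := exact_inj_ext (h := j ∘ f) (res_exactS T n) injI.
  by rewrite -composeA fd composem0.
by exists u; split=> //; rewrite -composeA ud composeA (ses0 sjp) compose0m.
Qed.

(** Hom(T, I) is acyclic in positive degrees, so the connecting map H^(n+1)(Hom(T, Z)) ->
    H^(n+2)(Hom(T, Y)) is an isomorphism. *)
Lemma cohomology_zero_shift n :
  cohomology_zero n.+2 Y <-> cohomology_zero n.+1 Z.
Proof.
split=> V f fd.
  have [u uf] := liftT f.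
  have [|g [jg gd]] := @connecting_map _ u; first by rewrite uf.
  have [h gh] := V g gd.
  have [|w ew] := exact_inj_ext (h := u - j ∘ h) (res_exactS T n) injI.
    by rewrite composeBl -jg gh composeA subrr.
  by exists (p ∘ w); rewrite -composeA ew composeBr uf composeA (ses0 sjp)
    compose0m subr0.
have [u [ud pud]] := connecting_map_inv fd.
have [w ew] := V _ pud; have [w' pw'] := liftT w.
have [|v jv] := ses_lift (t := u - w' ∘ res_d T n) sjp.
  by rewrite composeBr ew composeA pw' subrr.
exists v; apply: (ses_mono sjp).
by rewrite composeA jv composeBl -composeA res_dd composem0 subr0 ud.
Qed.

(** In the lowest degree, H^1(Hom(T, Y)) is the cokernel of Hom(X, I) -> Hom(X, Z). *)
Lemma cohomology1_zero :
  cohomology_zero 1 Y <-> forall f : hom X Z, exists g, p ∘ g = f.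
Proof.
split=> V f => [|fd].
  have [u uf] := liftT (f ∘ res_aug T).
  have [|g [jg gd]] := @connecting_map 0 u.
    by rewrite uf -composeA res_augd composem0.
  have [h gh] := V g gd.
  have [|w ew] := exact_inj_ext (h := u - j ∘ h) (res_exact0 T) injI.
    by rewrite composeBl -jg gh composeA subrr.
  exists w; apply: (@res_aug_epi _ _ T).
  by rewrite -composeA ew composeBr uf composeA (ses0 sjp) compose0m subr0.
have [u [ud pud]] := connecting_map_inv fd.
have [w ew] := exact_desc (res_exact0 T) (@res_aug_epi _ _ T) pud.
have [w' pw'] := V w.
have [|v jv] := ses_lift (t := u - w' ∘ res_aug T) sjp.
  by rewrite composeBr -ew composeA pw' subrr.
exists v; apply: (ses_mono sjp).
by rewrite composeA jv composeBl -composeA res_augd composem0 subr0 ud.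
Qed.

End DimensionShift.

(** * Projective dimension, Ext and cosyzygies *)

Section ProjectiveDimension.
Variables (C : abelian) (hP : enough_projectives C) (hI : enough_injectives C).
Implicit Types K M X Y Z I P : C.

(** Both sides shift in the same way along an embedding of [Y] into an injective, so every
    projective resolution detects the same vanishing. *)
Lemma cohomology_zeroE n X Y (P : proj_resolution X) :
  cohomology_zero (res_of_proj P) n.+1 Y <-> ext_zero n X Y.
Proof.
have lft I Z (p : hom I Z) : is_epi p ->
    forall n (f : hom (res_of_proj P n) Z), exists g, p ∘ g = f.
  by move=> epip k f; apply: pr_proj.
elim: n Y => [|n IH] Y; split.
- move=> V I Z j p injI sjp.
  exact: (cohomology1_zero injI sjp (lft _ _ _ sjp.2)).1 V.
- have [I [Z [j [p [injI sjp]]]]] := inj_ses_ex hI Y => E.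
  exact: (cohomology1_zero injI sjp (lft _ _ _ sjp.2)).2 (E _ _ _ _ injI sjp).
- move=> V I Z j p injI sjp.
  exact/IH/(cohomology_zero_shift injI sjp (lft _ _ _ sjp.2)).
have [I [Z [j [p [injI sjp]]]]] := inj_ses_ex hI Y => E.
apply/(cohomology_zero_shift injI sjp (lft _ _ _ sjp.2)).
exact/IH/(E _ _ _ _ injI sjp).
Qed.

(** [ext_zero] quantifies over all embeddings into injectives; through a projective resolution of
    [X], a single one suffices. *)
Lemma ext_zero_cosyzygy n X Y Z I (j : hom Y I) (p : hom I Z) :
  injective_obj I -> ses j p -> ext_zero n X Z -> ext_zero n.+1 X Y.
Proof.
move=> injI sjp E; have [P _] := proj_resolution_ex hP X.
apply/(cohomology_zeroE _ _ P)/(cohomology_zero_shift injI sjp).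
  by move=> k f; apply: pr_proj sjp.2.
exact/cohomology_zeroE.
Qed.

Lemma Ext_vanishesE n X Y : Ext_vanishes hP n.+1 X Y <-> ext_zero n X Y.
Proof.
set P := some_proj_resolution hP X.
have c0 : Ext_class (0 : cocycle P n.+1 Y) = 0.
  by apply: (addrI (Ext_class 0)); rewrite -Ext_classD !addr0.
rewrite -(cohomology_zeroE _ _ P); split=> V.
  move=> f /eqP fd; have := V (Ext_class (Cocycle fd : cocycle P n.+1 Y)).
  by rewrite -c0 => /Ext_classP; rewrite subr0.
move=> x; rewrite -(Ext_classK x) -c0; apply/Ext_classP; rewrite subr0.
by apply: V; case: (repr x) => f /= /eqP.
Qed.

Lemma pd_le_ext_zero m n X Y : (m <= n)%N -> pd_le X m -> ext_zero n X Y.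
Proof.
move=> mn [P zP]; apply/(cohomology_zeroE _ _ P) => f _.
by exists 0; apply: (zP n.+1 mn).1.
Qed.

Lemma pd_le0_projective P : projective P -> pd_le P 0.
Proof.
move=> prP; have [Z zZ] := zero_ex C.
pose T n := if n is 0 then P else Z.
have ex0 M N (g : hom M N) : is_mono g -> exact (0 : hom Z M) g.
  move=> mg; rewrite -(compose0m _ (idm Z)); apply: exact_ker_epi.
    apply: kernel_of_mono => [W a b _||W a /(mono0 mg) ->].
    - exact: zZ.2.
    - by rewrite composem0.
    - by exists 0; rewrite compose0m.
  by move=> W a b; rewrite !composem1.
have prT n : projective (T n) by case: n => //= _; apply: is_zero_proj.
unshelve eexists (@ProjResolution C P T (fun n => 0) (idm P) prT _ _ _).
- by move=> W a b; rewrite !composem1.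
- by apply: ex0 => W a b; rewrite !compose1m.
- by move=> n; apply: ex0 => W a b _; apply: zZ.2.
- by case.
Qed.

(** A resolution of the syzygy [K] is spliced onto [P] along [k]. *)
Lemma pd_leS_cover n K P X (k : hom K P) (c : hom P X) :
  projective P -> ses k c -> pd_le K n -> pd_le X n.+1.
Proof.
move=> prP skc [Q zQ].
pose T n := if n is n'.+1 then Q n' else P.
have prT i : projective (T i) by case: i => //= i; apply: pr_proj.
pose d i : hom (T i.+1) (T i) :=
  match i with 0 => k ∘ pr_aug Q | i'.+1 => pr_d Q i' end.
unshelve eexists (@ProjResolution C X T d c prT _ _ _).
- exact: skc.2.
- exact: exact_ker_epi skc.1 (@pr_aug_epi _ _ Q).
- case=> [|i] /=; last exact: pr_exactS.
  exact: exact_mono_comp (ses_mono skc) (pr_exact0 Q).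
- by case=> // i; apply: zQ.
Qed.

(** The converse passes to syzygies of [X] until only Ext^1 remains, whose vanishing makes the
    object projective. *)
Lemma pd_leE n X : pd_le X n <-> forall Y, ext_zero n X Y.
Proof.
split=> [pd Y|]; first exact: pd_le_ext_zero pd.
elim: n X => [|n IH] X E; first exact/pd_le0_projective/ext_zero_projective.
have [P [c [prP epic]]] := hP X.
apply: (pd_leS_cover prP (ses_ker epic)); apply: IH => Y.
by apply: (ext_zero_kernel hI (ses_ker epic)); first exact: projective_ext_zero.
Qed.

Lemma pd_leS n K P X (k : hom K P) (c : hom P X) :
  projective P -> ses k c -> pd_le X n.+1 <-> pd_le K n.
Proof.
move=> prP skc; split; last exact: pd_leS_cover prP skc.
move=> /pd_leE E; apply/pd_leE => Y.
by apply: (ext_zero_kernel hI skc); first exact: projective_ext_zero.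
Qed.

Lemma pd_le0 P : pd_le P 0 <-> projective P.
Proof.
by split=> [/pd_leE/(ext_zero_projective hP hI)|/pd_le0_projective].
Qed.

Lemma retract_pd_le n X M (s : hom X M) (r : hom M X) :
  r ∘ s = idm X -> pd_le M n -> pd_le X n.
Proof.
by move=> rs /pd_leE E; apply/pd_leE => Y; apply: retract_ext_zero rs _.
Qed.

Lemma coresolution_ses0 Y (J : inj_coresolution Y) :
  exists e : hom (J 0%N) (Im (ic_d J 0)), ses (ic_aug J) e.
Proof.
have [e [de epie]] := im_factor (ic_d J 0); exists e; split=> //.
apply: (kernel_mono_comp (h := im (ic_d J 0))); first exact: ker_mono.
rewrite de; apply: exact_mono_kernel (ic_exact0 J) _; exact: ic_aug_mono.
Qed.

Lemma coresolution_sesS Y (J : inj_coresolution Y) k :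
  exists e : hom (J k.+1) (Im (ic_d J k.+1)), ses (im (ic_d J k)) e.
Proof.
have [e [de epie]] := im_factor (ic_d J k.+1); exists e; split=> //.
apply: (kernel_mono_comp (h := im (ic_d J k.+1))); first exact: ker_mono.
by rewrite de; apply: ic_exactS.
Qed.

(** [Im (ic_d J k)] is cosyzygy number k + 1 and [ext_zero n] concerns Ext^(n+1), so the degrees
    compared are n + k + 2 and n + 1. *)
Lemma ext_zero_coresolution n k X Y (J : inj_coresolution Y) :
  ext_zero (n + k.+1) X Y <-> ext_zero n X (Im (ic_d J k)).
Proof.
elim: k n => [|k IH] n.
  have [e se] := coresolution_ses0 J; rewrite addn1; split=> [E|].
    exact: E _ _ _ _ (@ic_inj _ _ _ _) se.
  exact: ext_zero_cosyzygy (@ic_inj _ _ _ _) se.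
have [e se] := coresolution_sesS J k; rewrite -addSnnS; split=> [/IH E|E].
  exact: E _ _ _ _ (@ic_inj _ _ _ _) se.
exact/IH/(ext_zero_cosyzygy (@ic_inj _ _ _ _) se).
Qed.

Lemma pd_le_cosyzygy m X : (0 < m)%N ->
  pd_le X m <-> forall Y, cosyzygy m Y -> forall n, (1 <= n)%N ->
    Ext_vanishes hP n X Y.
Proof.
case: m => // m _; split=> [pd Y [B [J YJ]] [//|n] _|V].
  apply/Ext_vanishesE/(isomorphic_ext_zero YJ)/ext_zero_coresolution.
  by apply: pd_le_ext_zero pd; rewrite leq_addl.
apply/pd_leE => Y; have [J _] := injective_coresolution_ex hI Y.
(* Ext^1 against [Im (ic_d J m)], cosyzygy number m + 1, is Ext^(m+2)(X, Y), whose vanishing for all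
   [Y] bounds the dimension by m + 1. *)
rewrite -[m.+1]add0n; apply/(ext_zero_coresolution _ _ _ J)/Ext_vanishesE/V => //.
by exists Y, J, (idm _), (idm _); rewrite !compose1m.
Qed.

End ProjectiveDimension.

(** * Acyclic resolutions compute Ext *)

Lemma coboundary_lift (C : abelian) (X : C) (T : resolution X) (I Z : C)
    (p : hom I Z) n (f : hom (T n) Z) :
  (forall k (h : hom (T k) Z), exists g, p ∘ g = h) -> coboundary f ->
  exists c : hom (T n) I, p ∘ c = f /\ c ∘ res_d T n = 0.
Proof.
move=> lft; case: n f => [f ->|n f [s ->]].
  by exists 0; rewrite composem0 compose0m.
have [s' <-] := lft _ s.
exists (s' ∘ res_d T n); split; first by rewrite composeA.
by rewrite -composeA res_dd composem0.
Qed.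

Section ComparisonAcyclic.
Variables (C : abelian) (hI : enough_injectives C) (X : C).
Variables (T : resolution X) (Q : proj_resolution X).
Let Q' := res_of_proj Q.
Variable phi : forall n, hom (Q' n) (T n).
Hypothesis phi_aug : res_aug T ∘ phi 0 = res_aug Q'.
Hypothesis phi_d : forall n, res_d T n ∘ phi n.+1 = phi n ∘ res_d Q' n.

Definition acyclic Y := forall k n, ext_zero k (T n) Y.

Lemma acyclic_cosyzygy Y I Z (j : hom Y I) (p : hom I Z) :
  injective_obj I -> ses j p -> acyclic Y -> acyclic Z.
Proof. by move=> injI sjp aY k n; apply: (aY k.+1 n I Z j p). Qed.

Lemma acyclic_lift Y I Z (j : hom Y I) (p : hom I Z) :
  injective_obj I -> ses j p -> acyclic Y ->
  forall n (f : hom (T n) Z), exists g, p ∘ g = f.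
Proof. by move=> injI sjp aY n; apply: (aY 0%N n I Z j p). Qed.

(** Injectivity of H^n(Hom(T, Y)) -> H^n(Hom(Q, Y)). Connecting maps trade degree n + 1 in [Y] for
    degree n in [Z], for which [T] is again acyclic. *)
Lemma comparison_inj n Y (f : hom (T n) Y) : acyclic Y ->
  f ∘ res_d T n = 0 -> coboundary (T := Q') (f ∘ phi n) -> coboundary f.
Proof.
elim: n Y f => [|n IH] Y f aY fd.
  have [g gf] := exact_desc (res_exact0 T) (@res_aug_epi _ _ T) fd.
  rewrite /= -gf -composeA phi_aug => /(epi0 (@res_aug_epi _ _ Q')) ->.
  by rewrite compose0m.
case=> w fw; have [I [Z [j [p [injI sjp]]]]] := inj_ses_ex hI Y.
have [u [ud pud]] := connecting_map_inv injI sjp fd.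
(* For such a [c], the difference [u - c] lands in [Y] and its coboundary is [f]. *)
suff [c [pc cd]] : exists c : hom (T n) I, p ∘ c = p ∘ u /\ c ∘ res_d T n = 0.
  have [|r jr] := ses_lift (t := u - c) sjp; first by rewrite composeBr pc subrr.
  exists r; apply: (ses_mono sjp).
  by rewrite composeA jr composeBl cd subr0 ud.
have cw : (u ∘ phi n - j ∘ w) ∘ res_d Q' n = 0.
  by rewrite composeBl -!composeA -phi_d -fw composeA ud composeA subrr.
have pe : p ∘ (u ∘ phi n - j ∘ w) = p ∘ u ∘ phi n.
  by rewrite composeBr !composeA (ses0 sjp) compose0m subr0.
have aZ := acyclic_cosyzygy injI sjp aY.
(* In degree 0 a cocycle with values in [I] comes from a map on [X]; in higher degrees it is a
   coboundary and the induction hypothesis applies. *)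
case: n IH f fd u ud pud w fw cw pe => [|n] IH f fd u ud pud w fw cw pe.
  have [v ve] := exact_inj_ext (res_exact0 Q') injI cw.
  have [g ge] := exact_desc (res_exact0 T) (@res_aug_epi _ _ T) pud.
  have gv : g = p ∘ v.
    apply: (@res_aug_epi _ _ Q').
    by rewrite -composeA ve pe -phi_aug composeA ge.
  by exists (v ∘ res_aug T); rewrite composeA -gv ge -composeA res_augd composem0.
have [v ve] := exact_inj_ext (res_exactS Q' n) injI cw.
have [|s se] := IH _ _ aZ pud.
  by exists (p ∘ v); rewrite -pe -ve composeA.
by apply: coboundary_lift; [exact: acyclic_lift injI sjp aY|exists s].
Qed.

(** [g] comes from a cocycle [p ∘ u] one degree lower with values in [Z]; the induction hypothesis
    moves it to [T], and the connecting map of [T] brings it back to [Y]. *)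
Lemma comparison_surj n Y (g : hom (Q' n) Y) : acyclic Y ->
  g ∘ res_d Q' n = 0 ->
  exists f : hom (T n) Y,
    f ∘ res_d T n = 0 /\ coboundary (T := Q') (f ∘ phi n - g).
Proof.
elim: n Y g => [|n IH] Y g aY gd.
  have [h hg] := exact_desc (res_exact0 Q') (@res_aug_epi _ _ Q') gd.
  exists (h ∘ res_aug T); split; first by rewrite -composeA res_augd composem0.
  by rewrite /= -composeA phi_aug hg subrr.
have [I [Z [j [p [injI sjp]]]]] := inj_ses_ex hI Y.
have [u [ud pud]] := connecting_map_inv injI sjp gd.
have [f' [fd' cf']] := IH _ _ (acyclic_cosyzygy injI sjp aY) pud.
have [u' pu'] := acyclic_lift injI sjp aY f'.
have [|f [jf fd]] := connecting_map sjp (u := u'); first by rewrite pu'.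
exists f; split=> //.
(* The error [f' ∘ phi n - p ∘ u] lifts to a cocycle [c]; removing it leaves a map into [Y] that
   bounds [f ∘ phi n.+1 - g]. *)
have [|c [pc cd]] := coboundary_lift _ cf' (p := p).
  by move=> k h; apply: pr_proj sjp.2.
have [|r jr] := ses_lift (t := u' ∘ phi n - u - c) sjp.
  by rewrite !composeBr composeA pu' pc subrr.
exists r; apply: (ses_mono sjp).
rewrite composeA jr !composeBl cd subr0 composeBr ud composeA jf.
by rewrite -!composeA phi_d.
Qed.

End ComparisonAcyclic.

(** * Additivity and exactness of functors with adjoints *)

Section Adjoints.
Variables (C D : abelian) (F : functor C D) (G : functor D C).
Variable adj : adjunction F G.

(** Monicity of M -> Y + Z without choosing a biproduct, so that preservation by right adjoints
    needs no additivity. *)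
Definition joint_mono (E : abelian) (M Y Z : E) (a : hom M Y) (b : hom M Z) :=
  forall W (t t' : hom W M), a ∘ t = a ∘ t' -> b ∘ t = b ∘ t' -> t = t'.

Lemma adjoint_left_inj X Y (h h' : hom (F X) Y) :
  fmap G h ∘ unit adj X = fmap G h' ∘ unit adj X -> h = h'.
Proof.
have E (a : hom (F X) Y) : a = counit adj Y ∘ fmap F (fmap G a ∘ unit adj X).
  by rewrite fmap_comp composeA -counit_nat -composeA unit_counit composem1.
by move=> e; rewrite (E h) e -E.
Qed.

Lemma adjoint_rightE X Y (g : hom X (G Y)) :
  fmap G (counit adj Y ∘ fmap F g) ∘ unit adj X = g.
Proof. by rewrite fmap_comp -composeA unit_nat composeA counit_unit compose1m. Qed.

Lemma adjoint_right_inj X Y (g g' : hom X (G Y)) :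
  counit adj Y ∘ fmap F g = counit adj Y ∘ fmap F g' -> g = g'.
Proof. by move=> e; rewrite -(adjoint_rightE g) e adjoint_rightE. Qed.

Lemma right_adjoint_joint_mono (M Y Z : D) (a : hom M Y) (b : hom M Z) :
  joint_mono a b -> joint_mono (fmap G a) (fmap G b).
Proof.
move=> ab W t t' ea eb; apply: adjoint_right_inj.
apply: ab; rewrite !composeA counit_nat -!composeA -!fmap_comp.
  by rewrite ea.
by rewrite eb.
Qed.

Lemma right_adjoint_mono (M Y : D) (a : hom M Y) : is_mono a -> is_mono (fmap G a).
Proof.
move=> ma W t t' e.
by apply: (right_adjoint_joint_mono (a := a) (b := a) _ e e) => V s s' /ma.
Qed.

Lemma left_adjoint_epi (X Y : C) (f : hom X Y) : is_epi f -> is_epi (fmap F f).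
Proof.
move=> ef Z g h e; apply: adjoint_left_inj; apply: ef.
by rewrite -!composeA -unit_nat !composeA -!fmap_comp e.
Qed.

Lemma left_adjoint_projective :
  (forall (X Y : D) (f : hom X Y), is_epi f -> is_epi (fmap G f)) ->
  preserves_projectives F.
Proof.
move=> eG P prP X Y g f epig.
have [t et] := prP _ _ _ (fmap G f ∘ unit adj P) (eG _ _ _ epig).
exists (counit adj X ∘ fmap F t); apply: adjoint_left_inj.
by rewrite fmap_comp -composeA adjoint_rightE.
Qed.

(** A zero map factors through a zero object, which [G] sends to a terminal object. *)
Lemma right_adjoint0 (X Y : D) : fmap G (0 : hom X Y) = 0.
Proof.
have [Z zZ] := zero_ex D.
rewrite -(composem0 _ (0 : hom Z Y)) fmap_comp.
suff -> : fmap G (0 : hom X Z) = 0 by rewrite composem0.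
by apply: adjoint_right_inj; apply: zZ.2.
Qed.

(* A right adjoint preserves products, hence the biproduct diagram of Y with
   itself, through which f + g factors. *)
Lemma right_adjointD (X Y : D) (f g : hom X Y) :
  fmap G (f + g) = fmap G f + fmap G g.
Proof.
have [S [i1 [i2 [p1 [p2 [p11 p22 p12 p21 ip]]]]]] := biproduct_ex Y Y.
have jm : joint_mono p1 p2.
  move=> W t t' e1 e2; rewrite -(compose1m t) -(compose1m t') -ip !composeDl.
  by rewrite -!composeA e1 e2.
have -> : f + g = (p1 + p2) ∘ (i1 ∘ f + i2 ∘ g).
  rewrite composeDr !composeDl !composeA p11 p22 p12 p21.
  by rewrite !compose1m !compose0m addr0 add0r.
have -> : fmap G f + fmap G g =
    fmap G (p1 + p2) ∘ (fmap G i1 ∘ fmap G f + fmap G i2 ∘ fmap G g).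
  rewrite composeDr !composeA -!fmap_comp !composeDl p11 p22 p12 p21.
  by rewrite !compose1m !compose0m addr0 add0r.
rewrite fmap_comp; congr (_ ∘ _).
apply: (right_adjoint_joint_mono jm).
  rewrite composeDr !composeA -!fmap_comp composeDr !composeA p11 p12.
  by rewrite !compose1m !compose0m right_adjoint0 !addr0.
rewrite composeDr !composeA -!fmap_comp composeDr !composeA p22 p21.
by rewrite !compose1m !compose0m right_adjoint0 !add0r.
Qed.

Lemma right_adjoint_kernel (X Y K : D) (f : hom X Y) (k : hom K X) :
  is_kernel f k -> is_kernel (fmap G f) (fmap G k).
Proof.
move=> kk; apply: kernel_of_mono => [||W g fg].
- exact: right_adjoint_mono (is_kernel_mono kk).
- by rewrite -fmap_comp kk.1 right_adjoint0.
have [|h kh] := kernel_lift (g := counit adj X ∘ fmap F g) kk.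
  apply: adjoint_left_inj; rewrite fmap_comp -composeA adjoint_rightE fg.
  by rewrite right_adjoint0 compose0m.
exists (fmap G h ∘ unit adj W).
by rewrite composeA -fmap_comp kh adjoint_rightE.
Qed.

End Adjoints.

Lemma adjoint_exact (C D : abelian) (F : functor C D) (K G : functor D C) :
  adjunction K F -> adjunction F G -> exact_functor F.
Proof.
move=> aKF aFG; split=> [X Y f g|X Y Z f g ex]; first exact: right_adjointD aKF _ _ _ _.
have [e [fe epie]] := im_factor f; rewrite -fe fmap_comp.
apply: exact_ker_epi; first exact: right_adjoint_kernel aKF _ _ _ _ _ ex.
exact: left_adjoint_epi aFG _ _ _ epie.
Qed.

(** * Fully faithful functors *)

Section FullyFaithful.
Variables (C D : abelian) (F : functor C D).
Hypothesis ffF : fully_faithful F.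

Lemma fmap_inj X Y : injective (fmap F : hom X Y -> hom (F X) (F Y)).
Proof. exact: bij_inj. Qed.

Lemma fmap_full X Y (g : hom (F X) (F Y)) : exists f, fmap F f = g.
Proof. by have [h _ hK] := ffF X Y; exists (h g). Qed.

Lemma faithful_epi X Y (f : hom X Y) : is_epi (fmap F f) -> is_epi f.
Proof.
by move=> ef Z g h e; apply: fmap_inj; apply: ef; rewrite -!fmap_comp e.
Qed.

(** The inverse is the preimage under [F] of the counit at [F X], by the triangle identities. *)
Lemma ff_left_adjoint_unit_inv G (adj : adjunction F G) X :
  exists u : hom (G (F X)) X, u ∘ unit adj X = idm X /\ unit adj X ∘ u = idm _.
Proof.
have [u Fu] := fmap_full (counit adj (F X)); exists u; split.
  by apply: fmap_inj; rewrite fmap_comp fmap_id Fu unit_counit.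
by rewrite -unit_nat Fu counit_unit.
Qed.

End FullyFaithful.

(** * Homological embeddings from acyclicity *)

Section AcyclicEmbedding.
Variables (C D : abelian) (hC : enough_projectives C) (hD : enough_projectives D).
Variables (iD : enough_injectives D) (F : functor C D).
Hypotheses (exF : exact_functor F) (ffF : fully_faithful F).

Definition fmap_res (X : C) (P : proj_resolution X) : resolution (F X) :=
  Resolution (epi_fmap exF (@pr_aug_epi _ _ P)) (exF.2 _ _ _ _ _ (pr_exact0 P))
    (fun n => exF.2 _ _ _ _ _ (pr_exactS P n)).

Lemma coboundary_fmap (X Y : C) (P : proj_resolution X) n (f : hom (P n) Y) :
  coboundary (T := fmap_res P) (fmap F f) -> is_coboundary f.
Proof.
case: n f => [|n] f /=.
  by rewrite -(fmap0 exF); apply: fmap_inj.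
case=> g; have [g' <-] := fmap_full ffF g => e; exists g'.
by apply: (fmap_inj ffF); rewrite e fmap_comp.
Qed.

(** [F] turns a projective resolution of [X] into a resolution of [F X] acyclic for [F Y], which
    computes Ext; full faithfulness identifies its cochains with those over [X]. *)
Lemma acyclic_homological_embedding :
  (forall P Y, projective P -> forall k, ext_zero k (F P) (F Y)) ->
  homological_embedding hC hD F.
Proof.
move=> acF; exists exF => n X Y; rewrite /Ext_map /Ext.
set P := some_proj_resolution hC X; set Q := some_proj_resolution hD (F X).
have [phi0 phiS] := comparisonP exF P Q.
have acT : acyclic (fmap_res P) (F Y) by move=> k i; apply/acF/pr_proj.
set h := @Ext_res_map _ _ _ _ _ _ _ _ _.
have hi : injective h.
  move=> x y; rewrite -(Ext_classK x) -(Ext_classK y).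
  rewrite /h !Ext_res_map_class => /Ext_classP/=.
  rewrite -composeBl -fmapB => // c; apply/Ext_classP/coboundary_fmap.
  apply: (comparison_inj iD (T := fmap_res P) phi0 phiS acT _ c) => /=.
  rewrite -fmap_comp composeBl; case: (repr x) (repr y) => [a /= /eqP ->] [b /= /eqP ->].
  by rewrite subr0 fmap0.
have hs y : exists x, h x = y.
  rewrite -(Ext_classK y); case: (repr y) => g cg.
  have [f [fd cf]] := comparison_surj iD (T := fmap_res P) phi0 phiS acT (eqP cg).
  have [f' ff'] := fmap_full ffF f.
  have cf' : is_cocycle f'.
    apply/eqP; apply: (fmap_inj ffF).
    by rewrite fmap_comp ff' (fmap0 exF) -fd.
  exists (Ext_class (Cocycle cf')); rewrite /h Ext_res_map_class.
  by apply/Ext_classP; rewrite /= ff'.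
exists (fun y => projT1 (cid (hs y))) => [x|y]; last exact: projT2 (cid (hs y)).
by apply: hi; apply: (projT2 (cid (hs _))).
Qed.

End AcyclicEmbedding.

Lemma pullback_ex (C : abelian) (hP : enough_projectives C) (I X Z : C)
    (p : hom I Z) (f : hom X Z) : is_epi p ->
  exists (M : C) (a : hom M I) (b : hom M X),
    [/\ p ∘ a = f ∘ b, joint_mono a b & is_epi b].
Proof.
move=> epip; have [S [i1 [i2 [p1 [p2 [p11 p22 p12 p21 ip]]]]]] := biproduct_ex I X.
set m := ker (p ∘ p1 - f ∘ p2); exists _, (p1 ∘ m), (p2 ∘ m); split.
- apply/eqP; rewrite -subr_eq0 !composeA -composeBl; apply/eqP.
  exact: compose_ker.
- move=> W t t' e1 e2; apply: (@ker_mono _ _ _ (p ∘ p1 - f ∘ p2)).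
  rewrite -(compose1m (_ ∘ t)) -(compose1m (_ ∘ t')) -ip !composeDl.
  by rewrite -!composeA !(composeA p1) !(composeA p2) e1 e2.
(* [b] is an epimorphism because an epimorphism [c] from a projective factors through it. *)
have [Q [c [prQ epic]]] := hP X; have [t pt] := prQ _ _ _ (f ∘ c) epip.
have [|u mu] := kernel_lift (g := i1 ∘ t + i2 ∘ c) (kerP (p ∘ p1 - f ∘ p2)).
  rewrite composeDr !composeBl !composeA -!(composeA p) -!(composeA f).
  by rewrite p11 p22 p12 p21 !compose1m !compose0m !composem0 pt subr0 sub0r subrr.
apply: (@epi_comp_r _ _ _ _ u); rewrite -composeA mu.
by rewrite composeDr !composeA p21 p22 compose0m add0r compose1m.
Qed.

(** * Projective dimension and homological embeddings in a recollement *)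

Section Recollement.
Variables (A B C : abelian) (R : recollement A B C).
Variables (projB : enough_projectives B) (injB : enough_injectives B).
Let i := rec_i R.
Let e := rec_e R.
Let q := rec_q R.
Let l := rec_l R.
Let eta P := unit (adj_qi R) P.
Let eps P := counit (adj_le R) P.

Lemma rec_i_exact : exact_functor i.
Proof. exact: adjoint_exact (adj_qi R) (adj_ip R). Qed.

Lemma rec_ei_zero X : is_zero (e (i X)).
Proof.
by apply/essim_i; exists X, (idm _), (idm _); rewrite !compose1m.
Qed.

(** By adjunction Hom(l X, i Y) = Hom(X, e i Y), and e i = 0. *)
Lemma rec_hom_li (X : C) (Y : A) (f g : hom (l X) (i Y)) : f = g.
Proof. by apply: (adjoint_left_inj (adj := adj_le R)); apply: (rec_ei_zero Y).2. Qed.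

Lemma rec_ker_essim (Y : B) : idm (e Y) = 0 -> exists X, isomorphic (i X) Y.
Proof. by move=> /is_zero_idm/essim_i. Qed.

(* Ker e is closed under extensions, so the pullback of an extension of i(P)
   by i(Y) comes from A, where it splits. *)
Lemma ext_zero_rec_i (P Y : A) : projective P -> ext_zero 0 (i P) (i Y).
Proof.
move=> prP I Z j p injI sjp f.
have [M [a [b [pafb jm epib]]]] := pullback_ex projB f sjp.2.
have ea0 : fmap e a = 0.
  have kj := right_adjoint_kernel (adj_le R) sjp.1.
  have [|t jt] := kernel_lift (g := fmap e a) kj.
    rewrite -fmap_comp pafb fmap_comp ((rec_ei_zero P).2 _ (fmap e b) 0).
    by rewrite composem0.
  by rewrite -jt ((rec_ei_zero Y).2 _ t 0) composem0.
(* [e a] and [e b] are jointly monic and both zero, so [e M] is zero and [M] comes from [A]. *)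
have [|N [u [v [vu uv]]]] := rec_ker_essim (Y := M).
  apply: (right_adjoint_joint_mono (adj_le R) jm).
    by rewrite ea0 !compose0m.
  exact: (rec_ei_zero P).2.
have [h hbu] := fmap_full (ff_i R) (b ∘ u).
have epih : is_epi h.
  apply: (faithful_epi (ff_i R)); rewrite hbu => W x y xy; apply: epib.
  by rewrite -(composem1 (x ∘ b)) -(composem1 (y ∘ b)) -uv !composeA
    -!(composeA _ b u) xy.
have [s hs] := prP _ _ _ (idm P) epih.
exists (a ∘ u ∘ fmap i s).
by rewrite !composeA pafb -!composeA (composeA b) -hbu -fmap_comp hs fmap_id composem1.
Qed.

Lemma eta_eps P : eta P ∘ eps P = 0.
Proof. exact: rec_hom_li. Qed.

(** Under [e] the counit becomes a split epimorphism, so [e] kills [Coker (eps P)], which then lies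
    in the image of [i]. Hence [coker (eps P)] factors through [eta P], and what [eta P] kills lies
    in the image of [eps P]. *)
Lemma im_eps_kernel P : is_kernel (eta P) (im (eps P)).
Proof.
have [c [ec epic]] := im_factor (eps P).
apply: kernel_of_mono; first exact: ker_mono.
  by apply: (epi0 epic); rewrite -composeA ec eta_eps.
move=> W g etag.
have [|N [u [v [vu uv]]]] := rec_ker_essim (Y := Coker (eps P)).
  apply: (left_adjoint_epi (adj_er R) (coker_epi (f := eps P))).
  rewrite compose1m compose0m.
  have := counit_unit (adj_le R) P; rewrite -/(eps P) => id.
  rewrite -(composem1 (fmap e _)) -id composeA -fmap_comp coker_compose.
  by rewrite (right_adjoint0 (adj_le R)) compose0m.
have [w ew] : exists w, fmap i w ∘ eta P = v ∘ coker (eps P).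
  by eexists; apply: adjoint_rightE.
apply: ker_lift_ex; rewrite -(compose1m (coker _)) -uv -(composeA u) -ew.
by rewrite -!composeA etag !composem0.
Qed.

Lemma im_eps_ses P : ses (im (eps P)) (eta P).
Proof. by split; [apply: im_eps_kernel|apply: unit_qi_epi]. Qed.

Lemma H_ses P : ses (ker (eta P) : hom (H R P) P) (eta P).
Proof. exact/ses_ker/unit_qi_epi. Qed.

Lemma rec_q_projective : preserves_projectives q.
Proof.
apply: (left_adjoint_projective (adj_qi R)) => X Y f.
exact: left_adjoint_epi (adj_ip R) _ _ _.
Qed.

(** An epimorphism from a projective [Q] to [i P] factors through [eta Q]; the resulting [q Q] ->
    [P] is epi and splits. *)
Lemma projective_summand_q (P : A) : projective P ->
  exists (Q : B) (s : hom (i P) (i (q Q))) (r : hom (i (q Q)) (i P)),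
    projective Q /\ r ∘ s = idm (i P).
Proof.
move=> prP; have [Q [c [prQ epic]]] := projB (i P).
have [r er] : exists r, fmap i r ∘ eta Q = c by eexists; apply: adjoint_rightE.
have epir : is_epi r.
  by apply: (faithful_epi (ff_i R)); apply: (@epi_comp_r _ _ _ _ (eta Q)); rewrite er.
have [s rs] := prP _ _ _ (idm P) epir.
by exists Q, (fmap i s), (fmap i r); rewrite -fmap_comp rs fmap_id.
Qed.

Lemma pd_rec_i m :
  (forall P, projective P -> pd_le (i P) m) <->
  (forall Q, projective Q -> pd_le (i (q Q)) m).
Proof.
split=> pd P prP; first exact/pd/rec_q_projective.
have [Q [s [r [prQ rs]]]] := projective_summand_q prP.
exact: retract_pd_le projB injB _ _ _ _ _ rs (pd _ prQ).
Qed.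

(** The lifting problem is carried to [B] by [l], solved on the projective [Im (eps P)], and brought
    back by [e], the units of (l, e) being invertible. *)
Lemma im_eps_projective_e P : projective (Im (eps P)) -> projective (e P).
Proof.
move=> prI X Y g f epig; have [c [ec epic]] := im_factor (eps P).
have [s cs] := prI _ _ c (idm _) epic.
have [t gt] := prI _ _ (fmap l g) (fmap l f ∘ s) (left_adjoint_epi (adj_le R) epig).
have [x [xX Xx]] := ff_left_adjoint_unit_inv (ff_l R) (adj_le R) X.
have [y [yY Yy]] := ff_left_adjoint_unit_inv (ff_l R) (adj_le R) Y.
have [z [zZ Zz]] := ff_left_adjoint_unit_inv (ff_l R) (adj_le R) (e P).
pose v := fmap e c ∘ unit (adj_le R) (e P).
(* As [s] is a section of [c], [im (eps P)] equals [eps P ∘ s]; the claim becomes a triangle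
   identity. *)
have es : fmap e (eps P) ∘ (fmap e s ∘ v) = idm _.
  have := congr1 (fun h => h ∘ s) ec; rewrite /= -composeA cs composem1 => es.
  by rewrite composeA -fmap_comp -es /v composeA -fmap_comp ec; apply: counit_unit.
have ev : fmap e s ∘ v = unit (adj_le R) (e P).
  have ze : z = fmap e (eps P).
    by rewrite -[RHS]composem1 -Zz composeA counit_unit compose1m.
  by rewrite -(compose1m (_ ∘ v)) -Zz ze -composeA es composem1.
exists (x ∘ fmap e t ∘ v).
have ex : unit (adj_le R) Y ∘ g ∘ x = fmap e (fmap l g).
  by rewrite -unit_nat -composeA Xx composem1.
transitivity (y ∘ (unit (adj_le R) Y ∘ g ∘ x) ∘ fmap e t ∘ v).
  by rewrite !composeA yY compose1m.
rewrite ex -(composeA y) -fmap_comp gt fmap_comp -!composeA ev unit_nat.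
by rewrite composeA yY compose1m.
Qed.

Lemma pd_le1_preserves_projectives :
  (forall P, projective P -> pd_le (i P) 1) -> preserves_projectives e.
Proof.
move=> /pd_rec_i pd P prP; apply/im_eps_projective_e/(pd_le0 projB injB).
exact/(pd_leS projB injB _ prP (im_eps_ses P))/pd.
Qed.

Lemma pd_le1_homological_embedding (projA : enough_projectives A) :
  (forall P, projective P -> pd_le (i P) 1) -> homological_embedding projA projB i.
Proof.
move=> pd; apply: (acyclic_homological_embedding projA projB injB rec_i_exact (ff_i R)).
move=> P Y prP [|k]; first exact: ext_zero_rec_i.
exact: pd_le_ext_zero (pd P prP).
Qed.

(* The kernel of the epimorphism l e P -> Im (eps P) lies in i(A), and
   Ext^1(Im (eps P), i Y) = Ext^2(i q P, i Y) = Ext^2(q P, Y) = 0: it splits. *)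
Lemma homological_embedding_pd_le1
    (projA : enough_projectives A) (injA : enough_injectives A) :
  homological_embedding projA projB i -> preserves_projectives e ->
  forall P, projective P -> pd_le (i P) 1.
Proof.
move=> [exi bij] pre; apply/pd_rec_i => P prP.
apply/(pd_leS projB injB _ prP (im_eps_ses P))/(pd_le0 projB injB).
have [c [ec epic]] := im_factor (eps P); have sc := ses_ker epic.
have prL : projective (l (e P)).
  apply: (left_adjoint_projective (adj_le R)); last exact: pre.
  by move=> X Y f; apply: left_adjoint_epi (adj_er R) _ _ _.
(* [eps P] kills [ker c], and [e (eps P)], being inverse to a unit, is a monomorphism. *)
have ec0 : fmap e (ker c) = 0.
  have [z [_ Zz]] := ff_left_adjoint_unit_inv (ff_l R) (adj_le R) (e P).
  have me : is_mono (fmap e (eps P)).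
    move=> W a b ab; rewrite -(compose1m a) -(compose1m b) -Zz.
    have -> : z = fmap e (eps P).
      by rewrite -[RHS]composem1 -Zz composeA counit_unit compose1m.
    by rewrite -!composeA ab.
  have := congr1 (fun h => h ∘ ker c) ec; rewrite /= -composeA compose_ker composem0.
  move=> ek; apply: (mono0 me); rewrite -fmap_comp -ek.
  exact: right_adjoint0 (adj_le R) _ _.
have [|Y YK] := rec_ker_essim (Y := Ker c).
  apply: (right_adjoint_mono (adj_le R) (@ker_mono _ _ _ c)).
  by rewrite ec0 !compose0m.
have [u [v [vu uv]]] := YK.
have ext2 : ext_zero 1 (i (q P)) (i Y).
  apply/(Ext_vanishesE projB injB) => x.
  have [g _ gK] := bij 2 (q P) Y.
  have V : Ext_vanishes projA 2 (q P) Y.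
    by apply/(Ext_vanishesE projA injA)/projective_ext_zero/rec_q_projective.
  (* [g x] and [g 0] both vanish, and [g] is injective. *)
  by rewrite -(gK x) (V (g x)) -(V (g 0)) gK.
have ext1 : ext_zero 0 (Im (eps P)) (Ker c).
  apply: (isomorphic_ext_zero (Y := i Y)); first by exists v, u.
  by apply: (ext_zero_kernel injB (im_eps_ses P)); first exact: projective_ext_zero.
have [r rk] := ext_zero_retraction injB sc ext1.
have [s cs] := ses_section sc rk.
exact: retract_projective cs prL.
Qed.

End Recollement.

(** * The equivalences *)

Theorem proposition3p5 (A B C : abelian) (R : recollement A B C)
    (projA : enough_projectives A) (injA : enough_injectives A)
    (projB : enough_projectives B) (injB : enough_injectives B)
    (projC : enough_projectives C) (injC : enough_injectives C)
    (m : nat) (hm : (1 <= m)%N) :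
  let cond_i := forall P : A, projective P -> pd_le (rec_i R P) m in
  let cond_ii := forall Y : B, cosyzygy m Y ->
    forall P : A, projective P -> forall n : nat, (1 <= n)%N ->
    Ext_vanishes projB n (rec_i R P) Y in
  let cond_iii := forall P : B, projective P -> pd_le (H R P) m.-1 in
  let cond_iv := homological_embedding projA projB (rec_i R) /\
    preserves_projectives (rec_e R) in
  [/\ cond_i <-> cond_ii, cond_i <-> cond_iii
    & m = 1%N -> (cond_i <-> cond_iv)].
Proof.
move=> ci cii ciii civ; split.
- split=> [pd Y cY P prP|V P prP].
    exact: (pd_le_cosyzygy projB injB _ hm).1 (pd P prP) _ cY.
  by apply/(pd_le_cosyzygy projB injB _ hm) => Y cY; apply: V.
- rewrite /ci (pd_rec_i R projB injB) /ciii.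
  case: m hm {ci cii ciii civ} => // m _.
  by split=> pd P prP; apply/(pd_leS projB injB m prP (H_ses R P))/pd.
- move=> m1; rewrite /ci m1; split=> [pd|[he pe]].
    split; first exact: pd_le1_homological_embedding.
    exact: (pd_le1_preserves_projectives projB injB).
  exact: homological_embedding_pd_le1 he pe.
Qed.
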